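(* Let $\mathfrak{T}$ be a locally finite tree in which every vertex $x$ has a finite number $\nu(x)\ge 3$ of neighbours, and let $\omega$ be a fixed geodesic ray in $\mathfrak{T}$. Let $\mathcal{G}$ be a collection of maximal triangles in $\mathfrak{T}$ (that is, a collection of triangles each of which is maximal in $\mathcal{G}$), and set $G=\bigcup_{T\in\mathcal{G}}T$. Then for every $r\in[1,\infty)$ $$\Big\|\sum_{T\in\mathcal{G}}\mathbf{1}_T\Big\|_{r}\le A_r\,\big\|\mathbf{1}_G\big\|_{r},\qquad\text{where } A_r=4\sum_{k=1}^\infty k^r\,2^{-k}.$$
   Context: A tree is a connected graph with no loops (cycles); it is identified with its set of vertices, endowed with the graph distance $d$ and the counting measure $\mu$. The norm $\|\cdot\|_r$ is that of $L^r(\mathfrak{T},\mu)$ (with value $+\infty$ allowed), and $\mathbf{1}_E$ is the indicator function of $E$. The number $\nu(x)$ of neighbours of $x$ is finite for every $x$, but $\nu$ need not be bounded on $\mathfrak{T}$. A geodesic ray is a sequence $\omega=\{x_m:m\in\mathbb{N}\}$ of vertices with $d(x_i,x_j)=|i-j|$ for all $i,j$. Fix such a ray $\omega$. The height function is $h(x)=\lim_{m\to\infty}\big(m-d(x,x_m)\big)\in\mathbb{Z}$. Each vertex $x$ has exactly one neighbour of height $h(x)+1$, and its other $\nu(x)-1$ neighbours, called the successors of $x$, have height $h(x)-1$. Let $s^0(x)=\{x\}$, let $s^1(x)$ be the set of successors of $x$, and $s^k(x)=\bigcup_{y\in s^{k-1}(x)}s^1(y)$ for $k\ge2$. For an integer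 $R\ge0$, the triangle with vertex $x$ and height $R$ is $T_R(x)=\bigcup_{j=0}^R s^j(x)$; a triangle is any set of this form. Given a family $\mathcal{G}$ of triangles, $T\in\mathcal{G}$ is maximal in $\mathcal{G}$ if it is maximal with respect to inclusion, i.e. $T'\in\mathcal{G}$ and $T'\ne T$ imply $T'\cap T\ne T$. *)

(* Defs.v *)
From HB Require Import structures.
From mathcomp Require Import all_boot all_order all_algebra.
From mathcomp Require Import finmap.
From mathcomp Require Import all_classical all_reals all_analysis.

Set Implicit Arguments.
Unset Strict Implicit.
Unset Printing Implicit Defensive.

Import Order.TTheory GRing.Theory Num.Theory.
Import numFieldNormedType.Exports.

Local Open Scope classical_set_scope.
Local Open Scope ring_scope.

(* The graph is given by its adjacency relation e; a cycle is a closed path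
   through at least three pairwise distinct vertices. *)
Definition is_tree (V : choiceType) (e : rel V) : Prop :=
  [/\ symmetric e,
      irreflexive e,
      (forall x y : V, exists p : seq V, path e x p /\ last x p = y) &
      (forall c : seq V, ucycle e c -> (size c < 3)%N)].

Definition neighbours (V : choiceType) (e : rel V) (x : V) : set V :=
  [set y | e x y].

(* Meaningful only when neighbours e x is finite. *)
Definition nu (V : choiceType) (e : rel V) (x : V) : nat :=
  #|` fset_set (neighbours e x)|.

Definition joined_in (V : choiceType) (e : rel V) (x y : V) (n : nat) : Prop :=
  exists p : seq V, [/\ path e x p, last x p = y & size p = n].

(* Least length of a path from x to y; the value 0 for x and y in different
   components is never used in a tree. *)
Definition gdist (V : choiceType) (e : rel V) (x y : V) : nat :=
  match pselect (exists n, `[< joined_in e x y n >]) with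
  | left xy => ex_minn xy
  | right _ => 0%N
  end.

Definition geodesic_ray (V : choiceType) (e : rel V) (w : nat -> V) : Prop :=
  forall i j : nat, gdist e (w i) (w j) = `|i - j|%N.

(* The limit is taken in int with its discrete topology, where it is unique;
   the default value 0 is irrelevant when the limit exists. *)
Definition height (V : choiceType) (e : rel V) (w : nat -> V) (x : V) : int :=
  xget 0 [set z : int |
    (fun m : nat => m%:Z - (gdist e x (w m))%:Z : discrete_topology int) @ \oo
      --> (z : discrete_topology int)].

Definition successors (V : choiceType) (e : rel V) (w : nat -> V) (x : V) :
    set V :=
  [set y | neighbours e x y /\ height e w y = height e w x - 1].

Fixpoint iter_succ (V : choiceType) (e : rel V) (w : nat -> V) (k : nat)
    (x : V) : set V :=
  match k with
  | 0 => [set x]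
  | k'.+1 => \bigcup_(y in iter_succ e w k' x) successors e w y
  end.

Definition triangle (V : choiceType) (e : rel V) (w : nat -> V) (n : nat)
    (x : V) : set V :=
  \bigcup_(j in [set j | (j <= n)%N]) iter_succ e w j x.

Definition is_triangle (V : choiceType) (e : rel V) (w : nat -> V)
    (T : set V) : Prop :=
  exists (x : V) (n : nat), T = triangle e w n x.

Definition maximal_in (V : choiceType) (G : set (set V)) (T : set V) : Prop :=
  G T /\ forall T' : set V, G T' -> T' <> T -> T' `&` T <> T.

(* The measurable sets of V are all its subsets. *)
Definition count_norm (R : realType) (V : pointedType) (r : R)
    (f : V -> \bar R) : \bar R :=
  Lnorm (counting : {measure set (g_sigma_algebraType [set: set V]) -> \bar R})
    r%:E f.

Definition A_ (R : realType) (r : R) : \bar R :=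
  (4%:E * \sum_(1 <= k <oo) (k%:R `^ r * 2 ^- k)%:E)%E.

(* Main.v *)
(* Every vertex has a unique neighbour of height one more, hence at least two
   successors, so the set s^k(x) of descendants of x at depth k has at least
   2^k elements, and these sets are disjoint for distinct x. Two triangles
   through x that reach equally far below x are nested; hence the maximal ones
   have pairwise distinct depths below x, and if more than k of them contain x,
   then one contains s^k(x), which therefore lies in their union. When G is
   finite, this gives #{N > k} <= 2^-k #G for the number N(x) of triangles
   through x, so that sum N^r <= 2 sum_k k^r 2^-k #G; since that constant is at
   least 1, its r-th root does not exceed it. *)
Require Import Defs.
From mathcomp Require Import all_boot all_order all_algebra.
From mathcomp Require Import finmap zify.
From mathcomp Require Import all_classical all_reals all_analysis.

Set Implicit Arguments.
Unset Strict Implicit.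
Unset Printing Implicit Defensive.

Import Order.TTheory GRing.Theory Num.Theory.

Local Open Scope classical_set_scope.
Local Open Scope ring_scope.

(** * Distance and paths in a connected graph *)

Section GraphDistance.
Variables (V : choiceType) (e : rel V).
Hypothesis e_sym : symmetric e.
Hypothesis e_conn : forall x y : V, exists p : seq V, path e x p /\ last x p = y.

Lemma gdist_leq (p : seq V) (x : V) : path e x p ->
  (gdist e x (last x p) <= size p)%N.
Proof.
move=> px; rewrite /gdist; case: pselect => [h|//].
by case: ex_minnP => m _; apply; apply/asboolP; exists p.
Qed.

Lemma gdist_geodesic (x y : V) :
  exists p, [/\ path e x p, last x p = y & size p = gdist e x y].
Proof.
rewrite /gdist; case: pselect => [h|[]].
  by case: ex_minnP => m /asboolP.
by have [p [xp py]] := e_conn x y; exists (size p); apply/asboolP; exists p.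
Qed.

Lemma gdist_eq0 (x y : V) : gdist e x y = 0%N -> x = y.
Proof.
by have [p [_ <- <-]] := gdist_geodesic x y; move/size0nil => ->.
Qed.

Lemma gdist_triangle (x y z : V) :
  (gdist e x z <= gdist e x y + gdist e y z)%N.
Proof.
have [p [xp py <-]] := gdist_geodesic x y.
have [q [yq <- <-]] := gdist_geodesic y z.
by rewrite -py -last_cat -size_cat gdist_leq// cat_path xp py.
Qed.

Lemma gdist_adjacent (x y : V) : e x y -> (gdist e x y <= 1)%N.
Proof. by move=> xy; apply: (@gdist_leq [:: y] x); rewrite /= xy. Qed.

Lemma gdist_adjacent_leq (x y t : V) : e x y -> (gdist e x t <= (gdist e y t).+1)%N.
Proof.
move=> /gdist_adjacent xy; have := gdist_triangle x y t; lia.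
Qed.

Lemma geodesic_bounded (x t : V) :
  exists p, [/\ path e x p, last x p = t &
    {in x :: p, forall z, (gdist e z t <= gdist e x t)%N}].
Proof.
have [p [xp pt sp]] := gdist_geodesic x t; exists p; split=> // z.
move=> zp; rewrite -sp; case/splitPl: zp xp pt => p1 p2 p1z.
rewrite cat_path last_cat p1z size_cat => /andP[_ zp2] <-.
by rewrite (leq_trans (gdist_leq zp2)) ?leq_addl.
Qed.

(** That is, [y] and [z] lie in the same component of the graph with [x] deleted. *)
Definition connected_avoiding (x y z : V) : Prop :=
  exists p, [/\ path e y p, last y p = z & x \notin y :: p].

Lemma connected_avoiding_sym (x y z : V) :
  connected_avoiding x y z -> connected_avoiding x z y.
Proof.
move=> [p [yp pz xp]]; exists (rev (belast y p)); split.
- by rewrite -pz rev_path (eq_path (e' := e)).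
- by case: p {yp xp} pz => //= a p _; rewrite rev_cons last_rcons.
- by rewrite -pz -rev_rcons -lastI mem_rev.
Qed.

Lemma connected_avoiding_trans (x y z t : V) : connected_avoiding x y z ->
  connected_avoiding x z t -> connected_avoiding x y t.
Proof.
move=> [p [yp pz xp]] [q [zq qt xq]]; exists (p ++ q); split.
- by rewrite cat_path yp pz.
- by rewrite last_cat pz.
- move: xp xq; rewrite !inE !negb_or mem_cat => /andP[-> /negPf->].
  by move=> /andP[_ /negPf->].
Qed.

(** A geodesic from [y] to [t] never gets farther from [t] than [y] is, so it cannot meet [x]. *)
Lemma connected_avoiding_closer (x y t : V) : (gdist e y t < gdist e x t)%N ->
  connected_avoiding x y t.
Proof.
have [p [yp pt dp]] := geodesic_bounded y t => lt; exists p; split=> //.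
by apply/negP => /dp; rewrite leqNgt lt.
Qed.

Lemma exists_closer_neighbour (x t : V) : (0 < gdist e x t)%N ->
  exists2 y, e x y & (gdist e y t < gdist e x t)%N.
Proof.
have [[|y p] [xp pt <-] //= _] := gdist_geodesic x t.
move: xp pt => /= /andP[xy yp] <-; exists y => //.
by rewrite ltnS gdist_leq.
Qed.

End GraphDistance.

(** * Trees, the height function and successors *)

Section TreeHeight.
Variables (V : choiceType) (e : rel V).
Hypothesis e_tree : is_tree e.

Let e_sym : symmetric e. Proof. by case: e_tree. Qed.
Let e_conn (x y : V) : exists p : seq V, path e x p /\ last x p = y.
Proof. by case: e_tree. Qed.

(* Otherwise a simple path from [y] to [y'] avoiding [x] closes up to a cycle
   through [x]. *)
Lemma neighbours_separated (x y y' : V) : e x y -> e x y' ->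
  connected_avoiding e x y y' -> y = y'.
Proof.
move=> xy xy' [p [yp py' xp]]; case: e_tree => _ _ _ acyclic.
move: py' xp; case/shortenP: yp => q yq uq sub qy' xp.
have xq : x \notin y :: q.
  move: xp; rewrite !inE !negb_or => /andP[-> xp] /=.
  by apply: contra xp => /sub.
have /acyclic : ucycle e [:: x, y & q].
  apply/andP; split; last by rewrite cons_uniq xq.
  by rewrite /= rcons_path xy yq qy' e_sym.
by case: q {yq uq sub xq} qy'.
Qed.

Lemma closer_neighbour_unique (x y y' t : V) : e x y -> e x y' ->
  (gdist e y t < gdist e x t)%N -> (gdist e y' t < gdist e x t)%N -> y = y'.
Proof.
move=> xy xy' dy dy'; apply: (neighbours_separated xy xy').
apply: (connected_avoiding_trans (connected_avoiding_closer e_conn dy)).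
exact: (connected_avoiding_sym e_sym (connected_avoiding_closer e_conn dy')).
Qed.

(** Were the distances equal, a neighbour [x'] of [x] closer to [t] would be joined to [y] avoiding
    [x], through [t] and a neighbour [y'] of [y] closer to [t]. Then [x'] would be [y], which is not
    closer. *)
Lemma gdist_neighbour_neq (x y t : V) : e x y -> gdist e x t != gdist e y t.
Proof.
move=> xy; apply/eqP => dxy; case: e_tree => _ irr _ _.
have [d0|d_gt0] := posnP (gdist e x t).
  have xt := gdist_eq0 e_conn d0.
  have yt : y = t by apply: (gdist_eq0 e_conn); rewrite -dxy.
  by move: xy; rewrite xt yt irr.
have [x' xx' dx'] := exists_closer_neighbour e_conn d_gt0.
have [y' yy' dy'] : exists2 y', e y y' & (gdist e y' t < gdist e y t)%N.
  by apply: (exists_closer_neighbour e_conn); rewrite -dxy.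
suff x'y : x' = y by move: dx'; rewrite x'y dxy ltnn.
apply: (neighbours_separated xx' xy).
apply: (connected_avoiding_trans (connected_avoiding_closer e_conn dx')).
rewrite -dxy in dy'.
apply: (connected_avoiding_sym e_sym).
apply: connected_avoiding_trans (connected_avoiding_closer e_conn dy').
exists [:: y']; split => //=; first by rewrite yy'.
rewrite !inE negb_or; apply/andP; split.
  by apply/eqP => xy0; move: xy; rewrite xy0 irr.
by apply/eqP => xy'; move: dy'; rewrite xy' ltnn.
Qed.

Variables (w : nat -> V).
Hypothesis w_ray : geodesic_ray e w.

Lemma nondecreasing_bounded_stationary (u : nat -> nat) (b : nat) :
  (forall m, (u m <= u m.+1)%N) -> (forall m, (u m <= b)%N) ->
  exists l M, forall m, (M <= m)%N -> u m = l.
Proof.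
move=> u_nd u_b.
have ex : exists l, `[< exists m, u m = l >] by exists (u 0%N); apply/asboolP; exists 0%N.
have bd l : `[< exists m, u m = l >] -> (l <= b)%N by move=> /asboolP[m <-].
case: (ex_maxnP ex bd) => l /asboolP[M uM] max_l; exists l, M => m Mm.
apply/eqP; rewrite eqn_leq max_l ?andTb; last by apply/asboolP; exists m.
by rewrite -uM; apply: (homo_leq (r := leq)) => //; [exact: leq_trans].
Qed.

(* The Busemann sequence [m - d(x, w_m)] is nondecreasing and bounded, hence
   eventually constant. *)
Lemma height_eventually (x : V) : exists M, forall m, (M <= m)%N ->
  m%:Z - (gdist e x (w m))%:Z = height e w x.
Proof.
have d_step m : (gdist e x (w m.+1) <= (gdist e x (w m)).+1)%N.
  have := gdist_triangle e_conn x (w m) (w m.+1); rewrite w_ray; lia.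
have d_low m : (m <= gdist e (w 0%N) x + gdist e x (w m))%N.
  have := gdist_triangle e_conn (w 0%N) x (w m); rewrite w_ray; lia.
have d_up m : (gdist e x (w m) <= gdist e x (w 0%N) + m)%N.
  have := gdist_triangle e_conn x (w 0%N) (w m); rewrite w_ray; lia.
(* Adding [gdist e x (w 0)] keeps the subtraction in [nat] from truncating; [h] below removes the
   shift. *)
have [|m|l [M lM]] := @nondecreasing_bounded_stationary
    (fun m => (m + gdist e x (w 0%N) - gdist e x (w m))%N)
    (gdist e x (w 0%N) + gdist e (w 0%N) x)%N.
- move=> m; have := d_step m; have := d_up m; lia.
- have := d_low m; lia.
pose h := l%:Z - (gdist e x (w 0%N))%:Z.
have hM m : (M <= m)%N -> m%:Z - (gdist e x (w m))%:Z = h.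
  by move=> /lM; rewrite /h; have := d_up m; lia.
exists M => m Mm; rewrite hM // /height.
have cvg_h : (fun m : nat => m%:Z - (gdist e x (w m))%:Z : discrete_topology int)
    @ \oo --> (h : discrete_topology int).
  by apply: cvg_near_cst; exists M.
symmetry; apply: (@xget_unique _ (0 : int)) => [//|k cvg_k].
exact: (cvg_unique (@discrete_hausdorff (discrete_topology int)) cvg_k cvg_h).
Qed.

(** For large [m] the heights differ as the distances to [w m] do: by at most one, by the triangle
    inequality, and not by zero, since adjacent vertices of a tree are never equidistant from a
    vertex. *)
Lemma height_neighbour (x y : V) : e x y ->
  height e w y = height e w x + 1 \/ height e w y = height e w x - 1.
Proof.
move=> xy; have [M hM] := height_eventually x; have [N hN] := height_eventually y.
have := hM (maxn M N) (leq_maxl _ _); have := hN (maxn M N) (leq_maxr _ _).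
set t := w _ => hx hy; have := gdist_neighbour_neq t xy.
have := gdist_adjacent_leq e_conn t xy.
have := @gdist_adjacent_leq _ _ e_conn y x t; rewrite e_sym => /(_ xy).
lia.
Qed.

(** With respect to a far point [w m] of the ray, a higher neighbour is a closer one, and a closer
    neighbour is unique. *)
Lemma upper_neighbour_unique (x y y' : V) : e x y -> e x y' ->
  height e w y = height e w x + 1 -> height e w y' = height e w x + 1 -> y = y'.
Proof.
move=> xy xy' hy hy'.
have [M hM] := height_eventually x; have [N hN] := height_eventually y.
have [N' hN'] := height_eventually y'.
pose m := maxn M (maxn N N').
have := hM m (leq_maxl _ _); have := hN m; have := hN' m.
rewrite /m !leq_max !leqnn !orbT => /(_ isT) h1 /(_ isT) h2 h3.
by apply: (@closer_neighbour_unique x y y' (w m)) => //; rewrite /m; lia.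
Qed.

Lemma successors_parent_unique (x x' y : V) :
  successors e w x y -> successors e w x' y -> x = x'.
Proof.
move=> [xy hy] [xy' hy']; apply: (@upper_neighbour_unique y).
- by rewrite e_sym.
- by rewrite e_sym.
- lia.
- lia.
Qed.

Lemma exists_two_successors (x : V) : finite_set (neighbours e x) ->
  (3 <= nu e x)%N ->
  exists a b, [/\ successors e w x a, successors e w x b & a <> b].
Proof.
move=> fin; rewrite /nu; set F := fset_set _ => F3.
have eF z : z \in enum_fset F -> e x z.
  by move=> zF; have : z \in F by []; rewrite in_fset_set// inE.
have := fset_uniq F; move: F3 eF.
case: (enum_fset F) => [|a [|b [|c s]]] //= _ eF.
have [ea eb ec] : [/\ e x a, e x b & e x c].
  by split; apply: eF; rewrite !inE eqxx ?orbT.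
rewrite !inE !negb_or -!andbA => /and5P[/eqP ab /eqP ac _ /eqP bc _].
(* Of the eight patterns of heights, those with two higher neighbours are impossible; in each of the
   four others two of [a], [b], [c] are successors. *)
have [ha|ha] := height_neighbour ea; have [hb|hb] := height_neighbour eb;
  have [hc|hc] := height_neighbour ec;
  try (by case: ab; apply: (upper_neighbour_unique ea eb ha hb));
  try (by case: ac; apply: (upper_neighbour_unique ea ec ha hc));
  try (by case: bc; apply: (upper_neighbour_unique eb ec hb hc)).
- by exists b, c.
- by exists a, c.
- by exists a, b.
- by exists a, b.
Qed.

End TreeHeight.

(** * Descendants, triangles and their depth below a vertex *)

Section Descendants.
Variables (V : choiceType) (e : rel V) (w : nat -> V).

Lemma iter_succ_trans (i j : nat) (x z y : V) :
  iter_succ e w i x z -> iter_succ e w j z y -> iter_succ e w (j + i) x y.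
Proof.
by move=> xz; elim: j y => [|j IH] y /= => [->//|[t /IH zt ty]]; exists t.
Qed.

Lemma iter_succ_split (i j : nat) (x y : V) : iter_succ e w (j + i) x y ->
  exists2 z, iter_succ e w i x z & iter_succ e w j z y.
Proof.
elim: j y => [|j IH] y; first by exists y.
by move=> [t /IH[z xz zt] ty]; exists z => //; exists t.
Qed.

Hypothesis parent_unique : forall x x' y,
  successors e w x y -> successors e w x' y -> x = x'.

Lemma iter_succ_unique (j : nat) (z z' y : V) :
  iter_succ e w j z y -> iter_succ e w j z' y -> z = z'.
Proof.
elim: j y => [|j IH] y /= => [-> //|[t zt ty] [t' zt' ty']].
by apply: (IH t) => //; rewrite (parent_unique ty ty').
Qed.

(** [T] reaches [d] levels below its member [x]. This is a relation because a triangle is a bare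
    set, with no chosen vertex or height. *)
Definition triangle_depth (T : set V) (x : V) (d : nat) : Prop :=
  exists y j, iter_succ e w j y x /\ T = triangle e w (j + d) y.

Lemma triangle_depth_exists (T : set V) (x : V) :
  is_triangle e w T -> T x -> exists d, triangle_depth T x d.
Proof.
move=> [y [n ->]] [j /= jn yx]; exists (n - j)%N, y, j; split=> //.
by rewrite subnKC.
Qed.

Lemma iter_succ_sub_triangle (T : set V) (x : V) (d k : nat) :
  triangle_depth T x d -> (k <= d)%N -> iter_succ e w k x `<=` T.
Proof.
move=> [y [j [yx ->]]] kd z xz; exists (k + j)%N; first by rewrite /= addnC leq_add2l.
exact: iter_succ_trans xz.
Qed.

(** Both top vertices are ancestors of [x], so the lower one descends from the higher; as both
    triangles end [d] levels below [x], the one with the lower top lies in the other. *)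
Lemma triangle_depth_nested (T T' : set V) (x : V) (d : nat) :
  triangle_depth T x d -> triangle_depth T' x d -> T `<=` T' \/ T' `<=` T.
Proof.
move=> [y [j [yx ->]]] [y' [j' [y'x ->]]].
wlog jj' : y y' j j' yx y'x / (j <= j')%N.
  move=> H; have [jj'|/ltnW jj'] := leqP j j'; first exact: H.
  by case: (H y' y j' j) => //; [right | left].
left; move: y'x; rewrite -{1}(subnKC jj') => /iter_succ_split[t y't tx].
rewrite (iter_succ_unique yx tx) => z [i /= ijd tz].
exists (i + (j' - j))%N; first by rewrite /=; lia.
exact: iter_succ_trans tz.
Qed.

Lemma maximal_triangle_depth_inj (G : set (set V)) (T T' : set V) (x : V) (d : nat) :
  maximal_in G T -> maximal_in G T' ->
  triangle_depth T x d -> triangle_depth T' x d -> T = T'.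
Proof.
move=> [GT maxT] [GT' maxT'] Td T'd; apply: contrapT => TT'.
case: (triangle_depth_nested Td T'd) => [/setIidr|/setIidr].
  by apply: maxT => //; exact/nesym.
exact: maxT'.
Qed.

(** The depths below [x] of the members through [x] are distinct by maximality, and less than [k],
    since a greater depth would put [s^k(x)] inside the triangle. *)
Lemma few_triangles (G : set (set V)) (x : V) (k : nat) :
  (forall T, G T -> is_triangle e w T) -> (forall T, G T -> maximal_in G T) ->
  (forall T, G T -> T x -> ~ iter_succ e w k x `<=` T) ->
  finite_set [set T | G T /\ T x] /\ (#|` fset_set [set T | G T /\ T x]| <= k)%N.
Proof.
move=> G_tri G_max shallow; set Gx := [set T | _].
have [D hD] : {D : set V -> nat & forall T, Gx T -> triangle_depth T x (D T)}.
  apply: (@choice _ _ (fun T d => Gx T -> triangle_depth T x d)) => T.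
  (* Sets outside [Gx] get the default depth 0; injectivity is claimed on [Gx] only. *)
  have [GxT|] := pselect (Gx T); last by exists 0%N.
  by have [d] := triangle_depth_exists (G_tri _ GxT.1) GxT.2; exists d.
have D_inj : {in Gx &, injective D}.
  move=> T T' /set_mem GxT /set_mem GxT' DT.
  apply: (@maximal_triangle_depth_inj G T T' x (D T)).
  - exact: G_max GxT.1.
  - exact: G_max GxT'.1.
  - exact: hD.
  - by rewrite DT; exact: hD.
have Gxk : (Gx #<= `I_k)%card.
  rewrite -(card_le_eql (inj_card_eq D_inj)); apply: subset_card_le => _ [T GxT <-] /=.
  rewrite ltnNge; apply/negP => kD; apply: (shallow T GxT.1 GxT.2).
  exact: (iter_succ_sub_triangle (hD T GxT)).
by split; [exact: card_le_finite Gxk (finite_II k) | exact: geq_card_fset_set].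
Qed.

Variable child : bool -> V -> V.
Hypothesis childP : forall b x, successors e w x (child b x).
Hypothesis child_neq : forall x, child true x <> child false x.

(** A binary word codes a descent from [x], read from right to left: its last letter is the first
    step. *)
Lemma foldr_child (bs : seq bool) (x : V) :
  iter_succ e w (size bs) x (foldr child x bs).
Proof. by elim: bs => //= b bs IH; exists (foldr child x bs). Qed.

Lemma foldr_child_inj (bs bs' : seq bool) (x x' : V) : size bs = size bs' ->
  foldr child x bs = foldr child x' bs' -> x = x' /\ bs = bs'.
Proof.
elim: bs bs' => [|b bs IH] [|b' bs'] //= [sz] E.
have E' : foldr child x bs = foldr child x' bs'.
  by apply: (parent_unique (childP b _)); rewrite E; exact: childP.
have [-> ->] := IH _ sz E'; split=> //; congr cons.
move: E; rewrite E'; case: b; case: b' => // E; first by case: (child_neq E).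
by case: (child_neq (esym E)).
Qed.

(** The vertices coded by the [2 ^ k] words of length [k], started at the various [x] in [s], are
    pairwise distinct and all lie in [F]. *)
Lemma card_descendants (s : seq V) (F : seq V) (k : nat) : uniq s ->
  (forall x, x \in s -> iter_succ e w k x `<=` [set` F]) ->
  (size s * 2 ^ k <= size F)%N.
Proof.
move=> us sub.
pose t := [seq foldr child x (val bs) | x <- s, bs <- enum {: k.-tuple bool}].
have -> : (size s * 2 ^ k = size t)%N.
  by rewrite size_allpairs -cardE card_tuple card_bool.
apply: uniq_leq_size.
  apply: allpairs_uniq => //; first exact: enum_uniq.
  move=> [x bs] [x' bs'] _ _ /= /foldr_child_inj[]; first by rewrite !size_tuple.
  by move=> -> /val_inj ->.
move=> _ /allpairsP[[x bs] [/= /sub xF _ ->]]; apply: xF.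
by have := foldr_child (val bs) x; rewrite size_tuple.
Qed.

(** * Maximal families with finite union *)

Section MaximalFamily.
Variable G : set (set V).
Hypothesis G_triangles : forall T, G T -> is_triangle e w T.
Hypothesis G_maximal : forall T, G T -> maximal_in G T.
Hypothesis G_finite : finite_set (\bigcup_(T in G) T).

Let U := fset_set (\bigcup_(T in G) T).
Let through (x : V) := [set T | G T /\ T x].

(** With [k] the size of [U], a triangle through [x] containing [s^k(x)] would put [2 ^ k] vertices
    into a set of [k]; hence [few_triangles] applies. *)
Lemma finite_triangles_through (x : V) : finite_set (through x).
Proof.
apply: (few_triangles (k := #|` U|) G_triangles G_maximal _).1 => T GT Tx xT.
have : (size [:: x] * 2 ^ #|` U| <= size U)%N.
  apply: card_descendants => // y; rewrite inE => /eqP -> z /xT Tz.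
  by rewrite /= in_fset_set// inE; exists T.
by rewrite /= mul1n leqNgt ltn_expl.
Qed.

Lemma card_many_triangles (k : nat) :
  (count (fun x => k < #|` fset_set (through x)|)%N U * 2 ^ k <= #|` U|)%N.
Proof.
rewrite -size_filter; apply: card_descendants.
  by rewrite filter_uniq.
move=> x; rewrite mem_filter => /andP[kx _].
have [T [GT Tx xT]] : exists T, [/\ G T, T x & iter_succ e w k x `<=` T].
  apply: contrapT => H; move: kx; rewrite ltnNge => /negP; apply.
  apply: (few_triangles G_triangles G_maximal _).2 => T GT Tx xT.
  by apply: H; exists T.
by move=> y /xT Ty; rewrite /= in_fset_set// inE; exists T.
Qed.

End MaximalFamily.

End Descendants.

(** * Integrals and norms for the counting measure *)

Section CountingNorm.
Variables (R : realType) (V : pointedType).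

Let mu : {measure set (g_sigma_algebraType [set: set V]) -> \bar R} := counting.

Let measurable_all (A : set (g_sigma_algebraType [set: set V])) : measurable A.
Proof. exact: sub_sigma_algebra. Qed.

Let measurable_fun_all (d : measure_display) (T : measurableType d)
  (D : set (g_sigma_algebraType [set: set V]))
  (f : g_sigma_algebraType [set: set V] -> T) : measurable_fun D f.
Proof. by move=> _ B _; exact: measurable_all. Qed.

Lemma counting_finite (A : set V) : finite_set A ->
  counting A = (#|` fset_set A|%:R : R)%:E.
Proof. by move=> finA; rewrite /counting; case: asboolP. Qed.

(** The integrand vanishes off [A], which is a disjoint union of singletons of mass 1. *)
Lemma integral_counting_finite_support (A : set V) (f : V -> \bar R) :
  finite_set A -> (forall x, 0 <= f x)%E -> (forall x, ~ A x -> f x = 0) ->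
  (\int[mu]_x f x = \sum_(x <- fset_set A) f x)%E.
Proof.
move=> finA f_ge0 f0.
have -> : (\int[mu]_x f x = \int[mu]_(x in A) f x)%E.
  rewrite [RHS]integral_mkcond; apply: eq_integral => x _.
  by rewrite patchE; case: ifPn => // /negP; rewrite inE => /f0.
have {1}-> : A = \big[setU/set0]_(x <- fset_set A) [set x].
  by rewrite bigsetU_fset_set//; apply/seteqP; split=> [x Ax|x [y Ay ->]] //; exists x.
rewrite (@ge0_integral_bigsetU _ _ _ mu _ (fun x : V => [set x])) //.
- apply: eq_bigr => x _.
  rewrite (eq_integral (cst (f x))); last by move=> y; rewrite inE => ->.
  rewrite integral_cst// -[mu _]/(counting [set x]) counting_finite//.
  by rewrite fset_set1 cardfs1 mule1.
- exact: fset_uniq.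
- by apply/trivIsetP => i j _ _ /eqP ij; apply/seteqP; split=> // x [/= -> ].
Qed.

Lemma count_norm_finite (A : set V) (f : V -> \bar R) (r : R) : 0 < r ->
  finite_set A -> (forall x, 0 <= f x)%E -> (forall x, ~ A x -> f x = 0) ->
  count_norm r f = ((\sum_(x <- fset_set A) f x `^ r) `^ r^-1)%E.
Proof.
move=> r0 finA f_ge0 f0; rewrite /count_norm unlock.
rewrite (integral_counting_finite_support finA).
- by under eq_bigr do rewrite gee0_abs//.
- by move=> x; exact: poweR_ge0.
- by move=> x /f0 ->; rewrite abse0 poweR0r// gt_eqF.
Qed.

Lemma count_norm_indic_infinite (A : set V) (r : R) : 0 < r ->
  ~ finite_set A -> count_norm r (fun x => (\1_A x : R)%:E) = +oo%E.
Proof.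
move=> r0 infA; rewrite /count_norm unlock.
(* An indicator is its own [r]-th power; at 0 this needs [r] nonzero. *)
under eq_integral => x _.
  have -> : (`|(\1_A x : R)%:E| `^ r = (\1_A x : R)%:E)%E.
    rewrite indicE; case: (x \in A); rewrite ?abse1 ?abse0.
      by rewrite poweR1r.
    by rewrite poweR0r// gt_eqF.
  over.
rewrite integral_indic// setIT -[X in (X `^ _)%E]/(counting A) /counting.
rewrite asboolF//.
by rewrite poweRyr// invr_eq0 gt_eqF.
Qed.

(** Members missing [x] contribute 0, which leaves a finite sum of ones however large [G] is. *)
Lemma esum_indic (G : set (set V)) (x : V) : finite_set [set T | G T /\ T x] ->
  (\esum_(T in G) (\1_T x : R)%:E =
    (#|` fset_set [set T | G T /\ T x]|%:R)%:E)%E.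
Proof.
move=> fin; transitivity (\esum_(T in [set T | G T /\ T x]) (1 : \bar R))%E.
  rewrite (_ : [set T | G T /\ T x] = G `&` [set T | T x])// esum_mkcondr.
  apply: eq_esum => T _; rewrite indicE.
  rewrite (_ : (T \in [set T : set V | T x]) = (x \in T)); first by case: ifP.
  by apply/idP/idP; rewrite !inE.
rewrite esum_fset// fsbig_finite//= (sumEFin _ _ (fun=> 1)).
by rewrite -(natr_sum _ _ _ (fun=> 1%N)) sum1_size.
Qed.

End CountingNorm.

(** * Summation of the tail bound and the norm inequality *)

Lemma poweR_le_self (R : realType) (x : \bar R) (r : R) :
  (1 <= x)%E -> r <= 1 -> (x `^ r <= x)%E.
Proof.
case: x => [x|_ _|//]; last exact: leey.
by rewrite poweR_EFin !lee_fin => x1 r1; rewrite -[leRHS]powRr1 ?ler_powR// (le_trans ler01).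
Qed.

(* Grouping the terms by the value [k] of [n], which is taken at most
   [size s * 2 ^- k.-1] times. *)
Lemma sum_powR_geometric_tail (R : realType) (T : eqType) (s : seq T)
    (n : T -> nat) (r : R) :
  {in s, forall x, (0 < n x)%N} ->
  (forall k, (count (fun x => k < n x)%N s * 2 ^ k <= size s)%N) ->
  (\sum_(x <- s) ((n x)%:R `^ r)%:E <=
   2%:E * (\sum_(1 <= k <oo) (k%:R `^ r * 2 ^- k)%:E) * (size s)%:R%:E)%E.
Proof.
move=> n_gt0 tail; pose M := (\max_(x <- s) n x).+1.
have n_bd x : x \in s -> (1 <= n x < M)%N.
  by move=> xs; rewrite n_gt0//= ltnS leq_bigmax_seq.
have -> : (\sum_(x <- s) ((n x)%:R `^ r)%:E =
    (\sum_(1 <= k < M) k%:R `^ r * (count (fun x => n x == k) s)%:R)%:E)%E.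
  rewrite sumEFin; congr EFin; rewrite [LHS]big_seq.
  transitivity (\sum_(x <- s | x \in s) \sum_(1 <= k < M | k == n x) (k%:R `^ r : R)).
    by apply: eq_bigr => x xs; rewrite big_nat1_eq n_bd.
  rewrite -big_seq; under eq_bigr do rewrite big_mkcond.
  rewrite exchange_big /=; apply: eq_bigr => k _.
  rewrite -big_mkcond /= -sum1_count natr_sum mulr_sumr.
  by apply: eq_big => [x|x _]; rewrite 1?eq_sym// mulr1.
apply: (@le_trans _ _ (2%:E * (\sum_(1 <= k < M) (k%:R `^ r * 2 ^- k)%:E) * (size s)%:R%:E)%E).
  rewrite sumEFin -!EFinM lee_fin mulr_sumr mulr_suml ler_sum_nat// => k /andP[k1 _].
  rewrite mulrCA -!mulrA ler_wpM2l ?powR_ge0//.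
  (* With the index written [k.+1]: at most as many [x] have [n x = k.+1] as have [n x > k], and
     [2 ^- k = 2 * 2 ^- k.+1] produces the factor 2. *)
  case: k k1 => // k _; rewrite exprS invfM !mulrA divff// mul1r.
  rewrite mulrC ler_pdivlMr ?exprn_gt0// -natrX -natrM ler_nat.
  apply: leq_trans (tail k); rewrite leq_mul2r sub_count ?orbT// => x /= /eqP ->.
  exact: ltnSn.
apply: lee_wpmul2r; first by rewrite lee_fin.
apply: lee_wpmul2l; first by rewrite lee_fin.
apply: nneseries_lim_ge => k _ _.
by rewrite lee_fin mulr_ge0 ?powR_ge0// invr_ge0 exprn_ge0.
Qed.

Theorem lemma4p1 (R : realType) (V : pointedType) (e : rel V) (w : nat -> V)
    (e_tree : is_tree e)
    (e_locfin : forall x : V, finite_set (neighbours e x))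
    (nu_ge3 : forall x : V, (3 <= nu e x)%N)
    (w_ray : geodesic_ray e w)
    (G : set (set V))
    (G_triangles : forall T : set V, G T -> is_triangle e w T)
    (G_maximal : forall T : set V, G T -> maximal_in G T)
    (r : R) (r_ge1 : 1 <= r) :
  (count_norm r (fun x : V => \esum_(T in G) (\1_T x : R)%:E)
   <= A_ r * count_norm r (fun x : V => (\1_(\bigcup_(T in G) T) x : R)%:E))%E.
Proof.
have r_gt0 : 0 < r by exact: lt_le_trans r_ge1.
set S := (\sum_(1 <= k <oo) (k%:R `^ r * 2 ^- k)%:E)%E.
have term_ge0 k : (0 <= (k%:R `^ r * 2 ^- k : R)%:E)%E.
  by rewrite lee_fin mulr_ge0 ?powR_ge0// invr_ge0 exprn_ge0.
(* The term [k = 1] of [S] is already 1/2. *)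
have S_ge : ((2^-1 : R)%:E <= S)%E.
  apply: le_trans (nneseries_lim_ge 2 _) => //.
  by rewrite big_nat1 powR1 mul1r expr1.
have S_ge0 : (0 <= S)%E by apply: le_trans S_ge; rewrite lee_fin invr_ge0.
have S2_ge1 : (1 <= 2%:E * S)%E.
  apply: le_trans (lee_wpmul2l _ S_ge); last by rewrite lee_fin.
  by rewrite -EFinM divff.
have A_ge : (2%:E * S <= A_ r)%E by apply: lee_wpmul2r => //; rewrite lee_fin ler_nat.
have A_gt0 : (0 < A_ r)%E by apply: lt_le_trans A_ge; apply: lt_le_trans S2_ge1.
set U := \bigcup_(T in G) T.
(* For infinite [U] the right-hand side is [+oo], because [A_ r] is positive. *)
have [U_fin|U_inf] := pselect (finite_set U); last first.
  by rewrite count_norm_indic_infinite// gt0_muley// leey.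
have parent_unique := successors_parent_unique e_tree w_ray.
have [ab abP] : {ab : V -> V * V & forall x, [/\ successors e w x (ab x).1,
    successors e w x (ab x).2 & (ab x).1 <> (ab x).2]}.
  apply: (@choice _ _ (fun x ab => [/\ successors e w x ab.1,
    successors e w x ab.2 & ab.1 <> ab.2])) => x.
  have [a [b abx]] := exists_two_successors e_tree w_ray (e_locfin x) (nu_ge3 x).
  by exists (a, b).
pose child b x := if b then (ab x).1 else (ab x).2.
have childP b x : successors e w x (child b x) by case: b (abP x) => -[].
have child_neq x : child true x <> child false x by case: (abP x).
pose through x := [set T | G T /\ T x].
have through_fin x : finite_set (through x).
  exact: (finite_triangles_through parent_unique childP child_neq G_triangles).
rewrite (count_norm_finite (A := U)) //.
- rewrite (count_norm_finite (A := U)) //.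
  + rewrite [X in (_ <= _ * X `^ _)%E](_ : _ = (#|` fset_set U|)%:R%:E); last first.
      transitivity (\sum_(x <- fset_set U) (1%R : R)%:E)%E.
        rewrite [LHS]big_seq [RHS]big_seq; apply: eq_bigr => x.
        by rewrite in_fset_set// indicE => ->; rewrite poweR1r.
      by rewrite sumEFin -(natr_sum _ _ _ (fun=> 1%N)) sum1_size.
    rewrite (eq_bigr (fun x => ((#|` fset_set (through x)|%:R : R) `^ r)%:E));
      last by move=> x _; rewrite (esum_indic R (through_fin x)).
    have := @sum_powR_geometric_tail R V (fset_set U)
      (fun x => #|` fset_set (through x)|) r.
    move=> /(_ _ (card_many_triangles parent_unique childP child_neq
      G_triangles G_maximal U_fin)) bound.
    apply: (@le_trans _ _ ((2%:E * S * (#|` fset_set U|)%:R%:E) `^ r^-1)%E).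
      apply: gt0_ler_poweR; rewrite ?in_itv/= ?leey ?andbT ?invr_ge0 ?(ltW r_gt0)//.
      * by apply: sume_ge0 => x _; rewrite lee_fin powR_ge0.
      * by rewrite mule_ge0 ?lee_fin// (le_trans _ S2_ge1).
      apply: bound => x; rewrite in_fset_set// inE => -[T GT Tx].
      rewrite cardfs_gt0; apply/fset0Pn; exists T.
      by rewrite in_fset_set// inE.
    rewrite poweRM ?lee_fin// ?(le_trans _ S2_ge1)//.
    apply: lee_wpmul2r; first exact: poweR_ge0.
    (* As [2 * S] is at least 1 and [r^-1] at most 1, the root does not exceed [2 * S], which is at
       most [A_ r = 4 * S]; a value [+oo] of [S] is covered too. *)
    apply: le_trans A_ge; apply: poweR_le_self => //.
    by rewrite invf_le1.
  + by move=> x Ux; rewrite indicE memNset.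
- by move=> x; apply: esum_ge0 => T _; rewrite lee_fin.
- move=> x Ux; apply: esum1 => T GT; rewrite indicE memNset// => Tx.
  by apply: Ux; exists T.
Qed.
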